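(* The domain $\widetilde{\mathbf T}\subset\mathcal L$ modeling the universal Teichmüller space by Grunsky coefficients is not starlike with respect to the origin of $\mathcal L$; that is, there exist $\mathbf c\in\widetilde{\mathbf T}$ and $t\in[0,1]$ such that $t\mathbf c\notin\widetilde{\mathbf T}$.
   Context: Let $\mathbb D = \{|z|<1\}$, $\widehat{\mathbb C} = \mathbb C \cup \{\infty\}$, $\mathbb D^* = \{z\in\widehat{\mathbb C}:|z|>1\}$. Let $\Sigma$ be the collection of univalent nonvanishing functions in $\mathbb D^*$ with hydrodynamical normalization $f(z) = z + b_1 z^{-1}+\dots : \mathbb D^*\to\widehat{\mathbb C}\setminus\{0\}$. The Grunsky coefficients $c_{mn}$ of $f\in\Sigma$ are defined by $$\log\frac{f(z)-f(\zeta)}{z-\zeta} = -\sum_{m,n=1}^\infty c_{mn} z^{-m}\zeta^{-n},\quad (z,\zeta)\in(\mathbb D^* )^2$$ (principal branch); write $\mathbf c(f)=(c_{mn})$. Let $\Sigma_k\subset\Sigma$ be the functions with $k$-quasiconformal extensions to $\mathbb D$ and $\Sigma^0=\bigcup_{k} \Sigma_k$ $(0\le k<1)$. The Grunsky coefficients of functions in $\Sigma^0$ span a $\mathbb C$-linear space $\mathcal L^0$ of double sequences $\mathbf c=(c_{mn})$ satisfying $c_{mn}=c_{nm}$ and $|c_{mn}|\le C(\mathbf c)/\sqrt{mn}$ with a constant $C(\mathbf c)<\infty$ for all $m,n\ge1$, with finite norm $$\|\mathbf c\| = \sup_{m,n}\sqrt{mn}\,|c_{mn}| + \sup\Big\{\Big|\sum_{m,n=1}^\infty\sqrt{mn}\,c_{mn}x_mx_n\Big|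 : (x_n)\in l^2,\ \sum_{n\ge1}|x_n|^2=1\Big\}.$$ $\mathcal L$ is the closure of $\mathcal L^0$ in this norm (a Banach space). $\widetilde{\mathbf T}=\{\mathbf c(f): f\in\Sigma^0\}\subset\mathcal L$; it is a bounded domain in $\mathcal L$ containing the origin, biholomorphically equivalent to the universal Teichmüller space via $S_f\leftrightarrow \mathbf c(f)$, where $S_f$ is the Schwarzian derivative. *)

(* Defs.v *)
From HB Require Import structures.
From mathcomp Require Import all_boot all_order all_algebra complex.
From mathcomp Require Import all_classical all_reals all_analysis.

Set Implicit Arguments.
Unset Strict Implicit.
Unset Printing Implicit Defensive.

Import Order.TTheory GRing.Theory Num.Theory ComplexField.Normc.
Import numFieldNormedType.Exports.

Local Open Scope classical_set_scope.
Local Open Scope ring_scope.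
Local Open Scope complex_scope.

(* The library puts the norm topology only on R[i]^o; as it does for abstract
   number fields, transfer the structures to R[i] itself. *)
HB.instance Definition _ (R : realType) :=
  PseudoPointedMetric.copy R[i] R[i]^o.
HB.instance Definition _ (R : realType) := GRing.ComAlgebra.copy R[i] R[i]^o.
HB.instance Definition _ (R : realType) := Vector.copy R[i] R[i]^o.
HB.instance Definition _ (R : realType) := NormedModule.copy R[i] R[i]^o.

Section Quasiconformal.
Variable R : realType.
Implicit Types (F : R[i] -> R[i]) (k : R).

Definition plane_homeo F :=
  continuous F /\
  exists G : R[i] -> R[i], [/\ continuous G, cancel F G & cancel G F].

Definition abs_continuous (a b : R) (g : R -> R[i]) :=
  forall e : R, 0 < e -> exists2 d : R, 0 < d &
    forall (n : nat) (s t : 'I_n -> R),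
      (forall i, a <= s i /\ s i <= t i /\ t i <= b) ->
      (forall i j, i != j -> t i <= s j \/ t j <= s i) ->
      \sum_(i < n) (t i - s i) < d ->
      \sum_(i < n) normc (g (t i) - g (s i)) < e.

Definition ACL F :=
  {ae @lebesgue_measure R, forall y : R,
     forall a b : R, abs_continuous a b (fun x => F (x +i* y))} /\
  {ae @lebesgue_measure R, forall x : R,
     forall a b : R, abs_continuous a b (fun y => F (x +i* y))}.

(* [h] is real here: this is the real partial derivative in the direction [v]. *)
Definition has_partial F (v z l : R[i]) :=
  (h%:C)^-1 * (F (z + h%:C * v) - F z) @[h --> (0 : R)^'] --> l.

(* Analytic definition: an ACL homeomorphism of the plane with
   |F_zbar| <= k |F_z| almost everywhere, where F_z = (F_x - i F_y) / 2 and
   F_zbar = (F_x + i F_y) / 2. Such an [F] preserves orientation. *)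
Definition quasiconformal k F :=
  [/\ plane_homeo F, ACL F &
    {ae (@lebesgue_measure R \x @lebesgue_measure R)%E, forall p : R * R,
      exists Fx Fy : R[i],
        [/\ has_partial F 1 (p.1 +i* p.2) Fx,
            has_partial F 'i%C (p.1 +i* p.2) Fy &
            `|(Fx + 'i%C * Fy) / 2| <= k%:C * `|(Fx - 'i%C * Fy) / 2|]}].

End Quasiconformal.

Section Grunsky.
Variable R : realType.
Implicit Types (f : R[i] -> R[i]) (k : R).

(* The finite part of the exterior disk. A univalent f with f(oo) = oo has no
   finite pole, so it is given by its values here, and its behaviour at oo is
   recorded by the Laurent expansion in [Sigma]. *)
Definition Dstar : set R[i] := [set z | 1 < `|z|].

(* Values of [f] outside [Dstar] are irrelevant. [b n] is the coefficient of
   z^-(n+1) in f(z) = z + b_1 z^-1 + b_2 z^-2 + ... . *)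
Definition Sigma : set (R[i] -> R[i]) := [set f |
  [/\ forall z, Dstar z -> derivable f z 1,
      {in Dstar &, injective f},
      forall z, Dstar z -> f z != 0 &
      exists b : nat -> R[i], forall z, Dstar z ->
        series (fun n => b n * z ^- n.+1) @ \oo --> f z - z]].

(* An extension to the sphere fixes oo, hence restricts to a homeomorphism of
   the plane; isolated points are removable for quasiconformality. *)
Definition Sigma_qc k : set (R[i] -> R[i]) := [set f | Sigma f /\
  exists F, quasiconformal k F /\ {in Dstar, F =1 f}].

Definition Sigma0 : set (R[i] -> R[i]) :=
  [set f | exists2 k : R, 0 <= k < 1 & Sigma_qc k f].

(* [c m n] stands for c_{m+1,n+1}. *)
Local Notation dseq := (nat -> nat -> R[i]).

Definition square_sum (a : dseq) (N : nat) : R[i] :=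
  \sum_(m < N) \sum_(n < N) a m n.

Definition cexp (z : R[i]) : R[i] :=
  (expR (complex.Re z))%:C *
  (cos (complex.Im z) +i* sin (complex.Im z)).

(* log ((f z - f w) / (z - w)) = - sum c_mn z^-m w^-n. The branch is the one
   which is principal near (oo, oo), i.e. the single-valued branch on
   Dstar x Dstar vanishing at oo; it is singled out by the absence of a constant
   term in the series, so that the identity is stated through [cexp]. *)
Definition grunsky_coef f (c : dseq) := forall z w, Dstar z -> Dstar w ->
  let a : dseq := fun m n => c m n * z ^- m.+1 * w ^- n.+1 in
  (\esum_(p in [set: nat * nat]) (normc (a p.1 p.2))%:E < +oo)%E /\
  exists2 S : R[i], square_sum a @ \oo --> S &
    z != w -> cexp (- S) = (f z - f w) / (z - w).

Definition unit_l2 : set (nat -> R[i]) :=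
  [set x | series (fun n => normc (x n) ^+ 2) @ \oo --> (1 : R)].

Definition wcoef (c : dseq) : dseq :=
  fun m n => (Num.sqrt (m.+1 * n.+1)%:R)%:C * c m n.

Definition quad_sum (c : dseq) (x : nat -> R[i]) : nat -> R[i] :=
  square_sum (fun m n => wcoef c m n * x m * x n).

Definition coef_norm (c : dseq) : \bar R :=
  ereal_sup [set (normc (wcoef c p.1 p.2))%:E | p in [set: nat * nat]].

(* The upper limit is |sum_{m,n} sqrt(mn) c_mn x_m x_n| whenever the double
   series converges, as it does for all x if c is symmetric and the supremum is
   finite (the form is then bounded on l^2). *)
Definition quad_norm (c : dseq) : \bar R :=
  ereal_sup [set limn_esup (fun N => (normc (quad_sum c x N))%:E)
            | x in unit_l2].

Definition gnorm (c : dseq) : \bar R := (coef_norm c + quad_norm c)%E.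

(* The norm takes values in \bar R, so that its finiteness is a condition. *)
Definition gspace : set dseq := [set c |
  [/\ forall m n, c m n = c n m,
      exists C : R, forall m n,
        normc (c m n) <= C / Num.sqrt (m.+1 * n.+1)%:R &
      (gnorm c < +oo)%E]].

Definition grunsky_set : set dseq :=
  [set c | exists2 f, Sigma0 f & grunsky_coef f c].

Definition grunsky_span : set dseq := [set c |
  exists (n : nat) (a : 'I_n -> R[i]) (g : 'I_n -> dseq),
    (forall i, grunsky_set (g i)) /\ c = \sum_(i < n) a i *: g i].

Definition L0 : set dseq := gspace `&` grunsky_span.

(* Closure of [L0] inside the Banach space of all symmetric double sequences of
   finite norm. *)
Definition Lclosure : set dseq := [set c | gspace c /\
  forall e : R, 0 < e -> exists2 c0, L0 c0 & (gnorm (c - c0)%R < e%:E)%E].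

Implicit Types (c : dseq) (a : R[i]).

Lemma normc_ge0 (z : R[i]) : 0 <= normc z.
Proof. by case: z => x y; rewrite /= sqrtr_ge0. Qed.

Lemma wcoefD c d m n : wcoef (c + d) m n = wcoef c m n + wcoef d m n.
Proof. by rewrite /wcoef -mulrDr. Qed.

Lemma wcoefZ a c m n : wcoef (a *: c) m n = a * wcoef c m n.
Proof. by rewrite /wcoef mulrCA. Qed.

Lemma quad_sumD c d x N :
  quad_sum (c + d) x N = quad_sum c x N + quad_sum d x N.
Proof.
rewrite /quad_sum /square_sum -big_split; apply: eq_bigr => m _.
by rewrite -big_split; apply: eq_bigr => n _; rewrite wcoefD !mulrDl.
Qed.

Lemma quad_sumZ a c x N : quad_sum (a *: c) x N = a * quad_sum c x N.
Proof.
rewrite /quad_sum /square_sum mulr_sumr; apply: eq_bigr => m _.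
by rewrite mulr_sumr; apply: eq_bigr => n _; rewrite wcoefZ !mulrA.
Qed.

Lemma limn_esup_ge0 (u : nat -> \bar R) :
  (forall n, 0 <= u n)%E -> (0 <= limn_esup u)%E.
Proof.
move=> u0; rewrite limn_esup_lim; apply: lime_ge; first exact: is_cvg_esups.
apply: nearW => n; apply: (le_trans (u0 n)); apply: ereal_sup_ubound.
by exists n => /=.
Qed.

Lemma limn_esup_le (u v : nat -> \bar R) :
  (forall n, u n <= v n)%E -> (limn_esup u <= limn_esup v)%E.
Proof.
move=> uv; rewrite !limn_esup_lim; apply: lee_lim; [exact: is_cvg_esups..|].
apply: nearW => n; apply: ge_ereal_sup => _ [k /= nk <-].
by apply: (le_trans (uv k)); apply: ereal_sup_ubound; exists k.
Qed.

Lemma limn_esupD (u v : nat -> \bar R) :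
  (forall n, 0 <= u n)%E -> (forall n, 0 <= v n)%E ->
  (limn_esup (u \+ v) <= limn_esup u + limn_esup v)%E.
Proof.
move=> u0 v0; have E0 w n : (forall n, 0 <= w n)%E -> (0 <= esups (R:=R) w n)%E.
  move=> w0; apply: (le_trans (w0 n)); apply: ereal_sup_ubound.
  by exists n => /=.
rewrite !limn_esup_lim -limeD; [|exact: is_cvg_esups|exact: is_cvg_esups|].
  apply: lee_lim; [exact: is_cvg_esups|apply: is_cvgeD|].
  - by rewrite -!limn_esup_lim ge0_adde_def// inE limn_esup_ge0.
  - exact: is_cvg_esups.
  - exact: is_cvg_esups.
  apply: nearW => n; apply: ge_ereal_sup => _ [k /= nk <-].
  by apply: leeD; apply: ereal_sup_ubound; exists k.
by rewrite -!limn_esup_lim ge0_adde_def// inE limn_esup_ge0.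
Qed.

Lemma limn_esupZ (r : R) (u : nat -> \bar R) : 0 <= r ->
  (forall n, 0 <= u n)%E ->
  (limn_esup (fun n => r%:E * u n) <= r%:E * limn_esup u)%E.
Proof.
move=> r0 u0; rewrite !limn_esup_lim -limeMl//; last exact: is_cvg_esups.
apply: lee_lim; [exact: is_cvg_esups|apply: is_cvgeMl => //; exact: is_cvg_esups|].
apply: nearW => n; apply: ge_ereal_sup => _ [k /= nk <-].
by rewrite lee_wpmul2l ?lee_fin//; apply: ereal_sup_ubound; exists k.
Qed.

Lemma unit_l2_neq0 : unit_l2 !=set0.
Proof.
exists (fun n => (n == 0%N)%:R); apply: cvg_near_cst; near=> n.
rewrite /series /= big_ltn; last by near: n; exists 1%N.
rewrite eqxx normc1 expr1n big_nat big1 ?addr0// => i /andP[i0 _].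
by rewrite (gtn_eqF i0) normc0 expr0n.
Unshelve. all: by end_near. Qed.

Lemma coef_norm_ge0 c : (0 <= coef_norm c)%E.
Proof.
apply: (@le_trans _ _ (normc (wcoef c 0 0))%:E); first by rewrite lee_fin normc_ge0.
by apply: ereal_sup_ubound; exists (0%N, 0%N).
Qed.

Lemma quad_norm_ge0 c : (0 <= quad_norm c)%E.
Proof.
have [x ux] := unit_l2_neq0.
apply: (@le_trans _ _ (limn_esup (fun N => (normc (quad_sum c x N))%:E))).
  by apply: limn_esup_ge0 => n; rewrite lee_fin normc_ge0.
by apply: ereal_sup_ubound; exists x.
Qed.

Lemma gnormD c d : (gnorm (c + d)%R <= gnorm c + gnorm d)%E.
Proof.
rewrite /gnorm addeACA; apply: leeD; apply: ge_ereal_sup.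
  move=> _ [p _ <-]; apply: (@le_trans _ _
    ((normc (wcoef c p.1 p.2))%:E + (normc (wcoef d p.1 p.2))%:E)%E).
    by rewrite -EFinD lee_fin wcoefD le_normcD.
  by apply: leeD; apply: ereal_sup_ubound; exists p.
move=> _ [x ux <-]; apply: (@le_trans _ _
  (limn_esup (fun N => (normc (quad_sum c x N))%:E) +
   limn_esup (fun N => (normc (quad_sum d x N))%:E))%E).
  apply: le_trans (limn_esupD _ _); last 2 first.
  - by move=> n; rewrite lee_fin normc_ge0.
  - by move=> n; rewrite lee_fin normc_ge0.
  by apply: limn_esup_le => n; rewrite -EFinD lee_fin quad_sumD le_normcD.
by apply: leeD; apply: ereal_sup_ubound; exists x.
Qed.

Lemma gnormZ a c : (gnorm (a *: c)%R <= (normc a)%:E * gnorm c)%E.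
Proof.
rewrite /gnorm ge0_muleDr ?coef_norm_ge0 ?quad_norm_ge0//.
apply: leeD; apply: ge_ereal_sup.
  move=> _ [p _ <-]; rewrite wcoefZ normcM EFinM lee_wpmul2l ?lee_fin ?normc_ge0//.
  by apply: ereal_sup_ubound; exists p.
move=> _ [x ux <-]; apply: (@le_trans _ _
  ((normc a)%:E * limn_esup (fun N => (normc (quad_sum c x N))%:E))%E).
  apply: le_trans (limn_esupZ _ _); rewrite ?normc_ge0//; last first.
    by move=> n; rewrite lee_fin normc_ge0.
  by apply: limn_esup_le => n; rewrite -EFinM lee_fin quad_sumZ normcM.
rewrite lee_wpmul2l ?lee_fin ?normc_ge0//.
by apply: ereal_sup_ubound; exists x.
Qed.

Lemma gnorm0 : gnorm (0 : dseq) = 0%E.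
Proof.
apply/eqP; rewrite eq_le adde_ge0 ?coef_norm_ge0 ?quad_norm_ge0// andbT.
by have := gnormZ 0 0; rewrite scale0r normc0 mul0e.
Qed.

Lemma L0_0 : L0 0.
Proof.
split.
  split => //; last by rewrite gnorm0.
  by exists 0 => m n; rewrite mul0r normc0.
exists 0%N, (fun=> 0), (fun=> 0); split; first by case.
by rewrite big_ord0.
Qed.

Lemma gspaceP a c d : gspace c -> gspace d -> gspace (a *: c + d).
Proof.
move=> [cs [C cC] cf] [ds [D dD] df]; split.
- by move=> m n; rewrite !fctE cs ds.
- exists (normc a * C + D) => m n; rewrite !fctE.
  apply: (le_trans (le_normcD _ _)); rewrite mulrDl lerD// normcM -mulrA.
  by rewrite ler_wpM2l ?normc_ge0.
- apply: (le_lt_trans (gnormD _ _)); rewrite lte_add_pinfty//.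
  apply: (le_lt_trans (gnormZ _ _)); rewrite lte_mul_pinfty ?lee_fin ?normc_ge0//.
Qed.

Lemma grunsky_spanP a c d :
  grunsky_span c -> grunsky_span d -> grunsky_span (a *: c + d).
Proof.
move=> [m [s [g [gP ->]]]] [n [t [h [hP ->]]]].
exists (m + n)%N, (fun i : 'I_(m + n) => match fintype.split i with inl j => a * s j | inr j => t j end),
  (fun i : 'I_(m + n) => match fintype.split i with inl j => g j | inr j => h j end); split.
  by move=> i; case: (fintype.split i).
rewrite big_split_ord /= scaler_sumr; congr (_ + _); apply: eq_bigr => i _.
  by rewrite (unsplitK (inl _ i)) scalerA.
by rewrite (unsplitK (inr _ i)).
Qed.

Definition Lpred : {pred dseq} := fun c => c \in Lclosure.

Lemma Lpred_submod : GRing.submod_closed Lpred.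
Proof.
split.
  rewrite inE; split; first by have [] := L0_0.
  by move=> e e0; exists 0; rewrite ?subr0 ?gnorm0 ?lte_fin//; exact: L0_0.
move=> a c d; rewrite !inE => -[gc cP] [gd dP]; split; first exact: gspaceP.
move=> e e0; have a1 : 0 < normc a + 1 by rewrite ltr_wpDl ?normc_ge0.
have [c0 [gc0 sc0] cc0] := cP (e / 2 / (normc a + 1)) (divr_gt0 (divr_gt0 e0 (ltr0n _ 2)) a1).
have [d0 [gd0 sd0] dd0] := dP (e / 2) (divr_gt0 e0 (ltr0n _ 2)).
exists (a *: c0 + d0); first by split; [exact: gspaceP|exact: grunsky_spanP].
rewrite opprD addrACA -scalerBr.
apply: (le_lt_trans (gnormD _ _)); rewrite [e]splitr EFinD lteD//.
apply: (le_lt_trans (gnormZ _ _)).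
apply: (@le_lt_trans _ _ ((normc a)%:E * (e / 2 / (normc a + 1))%:E)%E).
  by rewrite lee_wpmul2l ?lee_fin ?normc_ge0// ltW.
rewrite -EFinM lte_fin mulrC mulrAC ltr_pdivrMr// ltr_pM2l ?ltrDl//.
by rewrite divr_gt0.
Qed.

HB.instance Definition _ :=
  GRing.isSubmodClosed.Build R[i] (nat -> nat -> R[i]) Lpred Lpred_submod.

Definition Lgrunsky := {c : dseq | c \in Lpred}.
HB.instance Definition _ := SubChoice.on Lgrunsky.
HB.instance Definition _ :=
  [SubChoice_isSubLmodule of Lgrunsky by <:].

Definition Ttilde : set Lgrunsky := [set c | grunsky_set (val c)].

End Grunsky.

(* The segment [p, c] is parametrized by p + t (c - p), t in [0, 1]. *)
Definition starlike_wrt (R : realType) (V : lmodType R[i]) (A : set V) (p : V) :=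
  forall (c : V) (t : R), A c -> 0 <= t <= 1 -> A (p + t%:C *: (c - p)).

(* Main.v *)
Require Import Defs.
From HB Require Import structures.
From mathcomp Require Import all_boot all_order all_algebra complex.
From mathcomp Require Import all_classical all_reals all_analysis.
From mathcomp Require Import ring lra.

Set Implicit Arguments.
Unset Strict Implicit.
Unset Printing Implicit Defensive.

Import Order.TTheory GRing.Theory Num.Theory.
Import numFieldNormedType.Exports.
Import ComplexField.Normc.

Local Open Scope classical_set_scope.
Local Open Scope ring_scope.
Local Open Scope complex_scope.

(** The Grunsky coefficients satisfy nonlinear relations, which a real multiple
    of a sequence of coefficients need not inherit. The simplest way to see this
    is to look at differences: if [c] consists of the Grunsky coefficients of
    [f], then [f z - f w] is determined by [c] for all [z] and [w], and these
    differences must satisfy the cocycle relation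
    [(f x - f y) + (f y - f z) = f x - f z].

    The witness is the Joukowski map [f(z) = z + k / z] with [0 < k < 1], for
    which [(f z - f w) / (z - w) = 1 - k / (z w)], so that its Grunsky matrix is
    diagonal with entries [k^n / n]. If half of that matrix were the Grunsky
    matrix of some [g], then [(g z - g w)^2 = (z - w)^2 (1 - k / (z w))]. With
    [X], [Y] the differences of [g] along [2, -2] and along [-2, 4], the numbers
    [X^2], [Y^2] and [(X + Y)^2] are thus known, and they contradict
    [((X + Y)^2 - X^2 - Y^2)^2 = 4 X^2 Y^2]: the two sides differ by [9 k^2].
    This is [half_joukowski_coef_not_grunsky].

    What remains is to show that the Joukowski map does define a point of the
    domain. Two facts carry this part.
    - [cvg_log_series]: the exponential of [- sum_n u^n / n] is [1 - u] on the
      complex unit disk. Along the ray from [0] to [u], both components of the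
      product of [exp (sum_n (s u)^n / n)] and [1 - s u] are differentiable
      functions of the real variable [s] with zero derivative.
    - [joukowski_ext_qc]: continued by [z + k z^*] in the unit disk, [f] becomes
      [z + k r(z)], where [r] maps [z] to [z^*] inside the unit circle and to
      [1 / z] outside. As [r] is 1-Lipschitz and [k < 1], this map is
      bi-Lipschitz onto its image, which gives injectivity, absolute continuity
      on lines and continuity of the inverse at once; surjectivity is an explicit
      computation with the roots of [z^2 - y z + k]. The quotient of the
      Wirtinger derivatives is [k] inside the circle and [0] outside, and the
      circle is a null set. *)

(** * The logarithmic series in the complex unit disk *)

Section PowerSeries.
Variable R : realType.
Implicit Types (f : R^nat) (u : R[i]).

(** The hypothesis under which power series are handled: it gives convergence and
    passes to the formal derivative at the price of an arbitrarily small increase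
    of the ratio. *)
Definition geo_bounded (rho : R) f :=
  exists2 M, 0 <= M & forall n, `|f n| <= M * rho ^+ n.

Lemma geo_bounded_cvg rho f (x : R) :
  0 <= rho -> rho * `|x| < 1 -> geo_bounded rho f -> cvgn (pseries f x).
Proof.
move=> rho0 rx [M M0 fM]; apply: normed_cvg.
apply: (@series_le_cvg _ _ (geometric M (rho * `|x|))) => [n|n|n|].
- exact: normr_ge0.
- by rewrite /= mulr_ge0// exprn_ge0// mulr_ge0.
- by rewrite /= exprMn mulrA normrM normrX ler_wpM2r.
- by apply: is_cvg_geometric_series; rewrite ger0_norm// mulr_ge0.
Qed.

Lemma geo_bounded_diffs rho sigma f : 0 <= rho -> rho < sigma ->
  geo_bounded rho f -> geo_bounded sigma (pseries_diffs f).
Proof.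
move=> rho0 rs [M M0 fM].
have sr : 0 < sigma - rho by rewrite subr_gt0.
have s0 : 0 < sigma by exact: le_lt_trans rs.
(* The left-hand side bounds [sigma ^+ n.+1 - rho ^+ n.+1] from below. *)
have growth n : n.+1%:R * (sigma - rho) * rho ^+ n <= sigma ^+ n.+1.
  elim: n => [|n IH]; first by rewrite expr0 expr1; lra.
  have e1 : rho ^+ n.+1 <= sigma ^+ n.+1 by rewrite lerXn2r ?nnegrE// ltW.
  have -> : n.+2%:R * (sigma - rho) * rho ^+ n.+1 =
      rho * (n.+1%:R * (sigma - rho) * rho ^+ n) + (sigma - rho) * rho ^+ n.+1.
    by rewrite -[n.+2%:R]natr1 exprS; ring.
  have -> : sigma ^+ n.+2 = rho * sigma ^+ n.+1 + (sigma - rho) * sigma ^+ n.+1.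
    by rewrite [LHS]exprS; ring.
  by rewrite lerD// ler_wpM2l// ltW.
exists (M * rho * sigma / (sigma - rho)) => [|n].
  by rewrite !mulr_ge0// ?invr_ge0 ltW.
rewrite normrM ger0_norm//.
apply: (@le_trans _ _ (n.+1%:R * (M * rho ^+ n.+1))); first by rewrite ler_wpM2l.
have -> : n.+1%:R * (M * rho ^+ n.+1) =
  M * rho / (sigma - rho) * (n.+1%:R * (sigma - rho) * rho ^+ n).
  by rewrite exprS; field; rewrite gt_eqF.
have -> : M * rho * sigma / (sigma - rho) * sigma ^+ n =
  M * rho / (sigma - rho) * sigma ^+ n.+1 by rewrite exprS; ring.
by rewrite ler_wpM2l// !mulr_ge0// invr_ge0 ltW.
Qed.

(** The closed interval lies inside the disk of convergence of the series and of
    its first two formal derivatives: there is room for two ratios between [rho]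
    and 1 and for a radius [K > 1] below the inverse of the larger one. *)
Lemma is_derive_pseries rho f (x : R) : 0 <= rho < 1 -> `|x| <= 1 ->
  geo_bounded rho f ->
  is_derive x (1 : R) (fun x => limn (pseries f x))
    (limn (pseries (pseries_diffs f) x)).
Proof.
move=> /andP[r0 r1] x1 fb.
pose s1 := (3 * rho + 1) / 4; pose s2 := (rho + 1) / 2.
pose K := 4 / (rho + 3).
have K0 : `|K| = K by rewrite ger0_norm// /K divr_ge0//; lra.
have Kc s : s * 4 < rho + 3 -> s * `|K| < 1.
  by move=> sr; rewrite K0 /K mulrA ltr_pdivrMr ?mul1r//; lra.
have b1 : geo_bounded s1 (pseries_diffs f).
  by apply: geo_bounded_diffs fb => //; rewrite /s1; lra.
have b2 : geo_bounded s2 (pseries_diffs (pseries_diffs f)).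
  by apply: geo_bounded_diffs b1; rewrite /s1 /s2; lra.
apply: (@pseries_snd_diffs _ _ K).
- by apply: geo_bounded_cvg fb => //; apply: Kc; lra.
- by apply: geo_bounded_cvg b1; [|apply: Kc]; rewrite /s1; lra.
- by apply: geo_bounded_cvg b2; [|apply: Kc]; rewrite /s2; lra.
- by apply: (le_lt_trans x1); rewrite K0 /K ltr_pdivlMr ?mul1r; lra.
Qed.

Lemma normrRe u : `|complex.Re u| <= normc u.
Proof.
case: u => a b /=; rewrite -sqrtr_sqr ler_sqrt ?lerDl ?sqr_ge0//.
by rewrite addr_ge0 ?sqr_ge0.
Qed.

Lemma normrIm u : `|complex.Im u| <= normc u.
Proof.
case: u => a b /=; rewrite -sqrtr_sqr ler_sqrt ?lerDr ?sqr_ge0//.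
by rewrite addr_ge0 ?sqr_ge0.
Qed.

Lemma normcX u n : normc (u ^+ n) = normc u ^+ n.
Proof. by elim: n => [|n IH]; rewrite ?normc1// !exprS normcM IH. Qed.

Lemma geo_bounded_ReX u : geo_bounded (normc u) (fun n => complex.Re (u ^+ n)).
Proof. by exists 1 => // n; rewrite mul1r -normcX normrRe. Qed.

Lemma geo_bounded_ImX u : geo_bounded (normc u) (fun n => complex.Im (u ^+ n)).
Proof. by exists 1 => // n; rewrite mul1r -normcX normrIm. Qed.

Lemma geo_bounded_divn rho f : geo_bounded rho f ->
  geo_bounded rho (fun n => f n / n%:R).
Proof.
move=> [M M0 fM]; exists M => // n; apply: le_trans (fM n).
rewrite normrM normfV [`|n%:R|]ger0_norm//.
case: n => [|n]; first by rewrite invr0 mulr0.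
by rewrite ler_pdivrMr// ler_peMr// ler1n.
Qed.

Lemma pseries_diffs_divn f : pseries_diffs (fun n => f n / n%:R) =
  (fun n => f n.+1).
Proof.
by apply/funext => n; rewrite /pseries_diffs mulrC divfK// pnatr_eq0.
Qed.

Lemma geo_bounded_shift rho f : 0 <= rho -> geo_bounded rho f ->
  geo_bounded rho (fun n => f n.+1).
Proof.
move=> r0 [M M0 fM]; exists (M * rho); first by rewrite mulr_ge0.
by move=> n; rewrite -mulrA -exprS.
Qed.

Lemma mulcRe u v : complex.Re (u * v) =
  complex.Re u * complex.Re v - complex.Im u * complex.Im v.
Proof. by case: u v => a b [c d]. Qed.

Lemma mulcIm u v : complex.Im (u * v) =
  complex.Re u * complex.Im v + complex.Im u * complex.Re v.
Proof. by case: u v => a b [c d]. Qed.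

Lemma lim_pseriesS f (x : R) :
  cvgn (pseries f x) -> cvgn (pseries (fun n => f n.+1) x) ->
  limn (pseries f x) = f 0%N + x * limn (pseries (fun n => f n.+1) x).
Proof.
move=> cf cSf; apply: cvg_lim => //; rewrite -cvg_shiftS.
rewrite (_ : (fun n => _) =
    (fun n => f 0%N + x * pseries (fun n => f n.+1) x n));last first.
  apply/funext => n; rewrite /pseries/= /series/= big_nat_recl// expr0 mulr1.
by rewrite mulr_sumr; congr (_ + _); apply: eq_bigr => i _; rewrite exprS mulrCA.
apply: cvgD; first exact: cvg_cst.
exact: cvgM (cvg_cst _) cSf.
Qed.

Lemma lim_pseries_lin (a b : R) f g (x : R) :
  cvgn (pseries f x) -> cvgn (pseries g x) ->
  limn (pseries (fun n => a * f n + b * g n) x) =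
    a * limn (pseries f x) + b * limn (pseries g x).
Proof.
move=> cf cg; apply: cvg_lim => //.
rewrite (_ : pseries _ _ = (fun n => a * pseries f x n + b * pseries g x n)).
  exact: cvgD (cvgM (cvg_cst _) cf) (cvgM (cvg_cst _) cg).
apply/funext => n; rewrite /pseries/= /series/= !mulr_sumr -big_split/=.
by apply: eq_bigr => i _; rewrite mulrDl !mulrA.
Qed.

Definition log_coefRe u n := complex.Re (u ^+ n) / n%:R : R.
Definition log_coefIm u n := complex.Im (u ^+ n) / n%:R : R.

(** With [S s] the sum of [(s u)^n / n] over [n], the derivative of [S] is
    [u / (1 - s u)], so that [exp (S s) (1 - s u)] is constant in [s]. Its real and
    imaginary parts at [s = 1] are compared with those at [s = 0]. *)
Lemma log_series_real u (A := limn (pseries (log_coefRe u) 1))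
    (B := limn (pseries (log_coefIm u) 1)) : normc u < 1 ->
  expR A * (cos B * (1 - complex.Re u) + sin B * complex.Im u) = 1 /\
  expR A * (sin B * (1 - complex.Re u) - cos B * complex.Im u) = 0.
Proof.
rewrite {}/A {}/B => u1.
have u0 := normc_ge0 u.
have gRe := geo_bounded_ReX u; have gIm := geo_bounded_ImX u.
pose A s := limn (pseries (log_coefRe u) s).
pose B s := limn (pseries (log_coefIm u) s).
pose X s := limn (pseries (fun n => complex.Re (u ^+ n.+1)) s).
pose Y s := limn (pseries (fun n => complex.Im (u ^+ n.+1)) s).
have cvs f s : `|s| <= 1 -> geo_bounded (normc u) f -> cvgn (pseries f s).
  move=> s1; apply: geo_bounded_cvg => //.
  by apply: le_lt_trans u1; rewrite ler_piMr.
have dA s : `|s| <= 1 -> is_derive s (1 : R) A (X s).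
  move=> s1; rewrite /X -(pseries_diffs_divn (fun n => complex.Re (u ^+ n))).
  apply: (@is_derive_pseries (normc u)); [exact/andP|by []|].
  exact: geo_bounded_divn.
have dB s : `|s| <= 1 -> is_derive s (1 : R) B (Y s).
  move=> s1; rewrite /Y -(pseries_diffs_divn (fun n => complex.Im (u ^+ n))).
  apply: (@is_derive_pseries (normc u)); [exact/andP|by []|].
  exact: geo_bounded_divn.
have gRe1 := geo_bounded_shift u0 gRe; have gIm1 := geo_bounded_shift u0 gIm.
have gRe2 := geo_bounded_shift u0 gRe1; have gIm2 := geo_bounded_shift u0 gIm1.
set p := complex.Re u; set q := complex.Im u.
(* [X + i Y] is a geometric series: removing its first term gives
   [X + i Y = u + s u (X + i Y)]. *)
have XE s : `|s| <= 1 -> X s = p + s * (p * X s - q * Y s).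
  move=> s1; rewrite {1}/X lim_pseriesS; [|exact: cvs..].
  congr (_ + s * _); rewrite -mulNr -lim_pseries_lin; [|exact: cvs..].
  by congr (limn (pseries _ _)); apply/funext => n; rewrite exprS mulcRe mulNr.
have YE s : `|s| <= 1 -> Y s = q + s * (p * Y s + q * X s).
  move=> s1; rewrite {1}/Y lim_pseriesS; [|exact: cvs..].
  congr (_ + s * _); rewrite -lim_pseries_lin; [|exact: cvs..].
  by congr (limn (pseries _ _)); apply/funext => n; rewrite exprS mulcIm.
pose P s := expR (A s) * (cos (B s) * (1 - s * p) + sin (B s) * (s * q)).
pose Q s := expR (A s) * (sin (B s) * (1 - s * p) - cos (B s) * (s * q)).
have dP s : `|s| <= 1 -> is_derive s (1 : R) P 0.
  move=> s1; have dAs := dA _ s1; have dBs := dB _ s1.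
  apply: trigger_derive; rewrite /GRing.scale /=.
  transitivity (expR (A s) *
    (cos (B s) * (X s - (p + s * (p * X s - q * Y s))) -
     sin (B s) * (Y s - (q + s * (p * Y s + q * X s))))); first by ring.
  by rewrite -XE// -YE// !subrr !mulr0 subrr mulr0.
have dQ s : `|s| <= 1 -> is_derive s (1 : R) Q 0.
  move=> s1; have dAs := dA _ s1; have dBs := dB _ s1.
  apply: trigger_derive; rewrite /GRing.scale /=.
  transitivity (expR (A s) *
    (sin (B s) * (X s - (p + s * (p * X s - q * Y s))) +
     cos (B s) * (Y s - (q + s * (p * Y s + q * X s))))); first by ring.
  by rewrite -XE// -YE// !subrr !mulr0 addr0 mulr0.
have cst (f : R -> R) :
    (forall s, `|s| <= 1 -> is_derive s (1 : R) f 0) -> f 1 = f 0.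
  move=> df; have in01 (s : R) : s \in `[0, 1]%R -> `|s| <= 1.
    by rewrite in_itv/= => /andP[s0 s1]; rewrite ger0_norm.
  have [||c _] := @MVT_segment _ f (fun=> 0) 0 1 ler01.
  - by move=> s s01; apply: df; apply: in01; exact: subset_itv_oo_cc.
  - apply: derivable_within_continuous => s s01.
    by have := df s (in01 s s01) => -[].
  - by rewrite mul0r => /eqP; rewrite subr_eq0 => /eqP.
have A0 : A 0 = 0.
  rewrite /A lim_pseriesS ?mul0r ?addr0; first by rewrite /log_coefRe invr0 mulr0.
  - apply: cvs; rewrite ?normr0//; exact: geo_bounded_divn.
  - apply: cvs; rewrite ?normr0//; apply: geo_bounded_shift => //.
    exact: geo_bounded_divn.
have B0 : B 0 = 0.
  rewrite /B lim_pseriesS ?mul0r ?addr0; first by rewrite /log_coefIm invr0 mulr0.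
  - apply: cvs; rewrite ?normr0//; exact: geo_bounded_divn.
  - apply: cvs; rewrite ?normr0//; apply: geo_bounded_shift => //.
    exact: geo_bounded_divn.
have := cst _ dP; have := cst _ dQ.
by rewrite /P /Q A0 B0 expR0 cos0 sin0 !mul0r !mulr0 !mul1r !subr0 addr0.
Qed.

(** Convergence for the complex-valued norm, tested with real radii only. *)
Lemma cvg_normc T (F : set_system T) (FF : Filter F) (f : T -> R[i]) (l : R[i]) :
  (forall e : R, 0 < e -> \forall t \near F, normc (l - f t) < e) ->
  f @ F --> l.
Proof.
move=> fl; apply/cvgrPdist_lt => e; rewrite ltcE /= => /andP[/eqP ei er].
have -> : e = (complex.Re e)%:C by move: ei; case: e {er} => a b /= ->.
by near=> t; rewrite ltcR; near: t; exact: fl.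
Unshelve. all: by end_near. Qed.

Lemma cvg_complex T (F : set_system T) (FF : Filter F) (f g : T -> R) (a b : R) :
  f @ F --> a -> g @ F --> b -> (fun t => f t +i* g t) @ F --> a +i* b.
Proof.
move=> fa gb; apply: cvg_normc => e e0.
have e2 : 0 < e / 2 by rewrite divr_gt0.
near=> t; rewrite (_ : _ - _ = (a - f t)%:C + (b - g t)%:C * 'i); last first.
  by simpc.
apply: (le_lt_trans (le_normcD _ _)); rewrite [e]splitr ltrD//.
  rewrite /= expr0n addr0 sqrtr_sqr; near: t.
  by move/cvgrPdist_lt : fa => /(_ _ e2).
rewrite normcM /= expr1n expr0n !addr0 add0r sqrtr1 mulr1 sqrtr_sqr; near: t.
by move/cvgrPdist_lt : gb => /(_ _ e2).
Unshelve. all: by end_near. Qed.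

Lemma cvg_log_series u : normc u < 1 ->
  exists2 S : R[i], series (fun n => u ^+ n.+1 / n.+1%:R) @ \oo --> S &
    cexp (- S) = 1 - u.
Proof.
move=> u1; have [re im] := log_series_real u1.
have cvgS f : f 0%N = 0 -> geo_bounded (normc u) f ->
    series (fun n => f n.+1) @ \oo --> limn (pseries f 1).
  move=> f0 gf; have cf : cvgn (pseries f 1).
    by apply: geo_bounded_cvg gf; rewrite ?normc_ge0// normr1 mulr1.
  rewrite (_ : series _ = (fun n => pseries f 1 n.+1)); first by rewrite cvg_shiftS.
  apply/funext => n; rewrite /pseries/= /series/= big_nat_recl// f0 mul0r add0r.
  by apply: eq_bigr => i _; rewrite expr1n mulr1.
have cRe := cvgS (log_coefRe u) _ (geo_bounded_divn (geo_bounded_ReX u)).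
have cIm := cvgS (log_coefIm u) _ (geo_bounded_divn (geo_bounded_ImX u)).
set A := limn _ in re im cRe; set B := limn _ in re im cIm.
exists (A +i* B).
  rewrite (_ : series _ = fun n => series (fun n => log_coefRe u n.+1) n +i*
    series (fun n => log_coefIm u n.+1) n).
    by apply: cvg_complex; [apply: cRe|apply: cIm];
      rewrite /log_coefRe /log_coefIm invr0 mulr0.
  apply/funext => n; rewrite /series/=.
  elim: n => [|n IH]; first by rewrite !big_nil.
  rewrite !big_nat_recr//= IH /log_coefRe /log_coefIm; case: (u ^+ n.+1) => a b.
  rewrite -(rmorph_nat (real_complex R)) -fmorphV/=.
  by simpc.
rewrite /cexp /= expRN cosN sinN; set E := expR A in re im *.
have E0 : E != 0 by rewrite gt_eqF// expR_gt0.
have cs := cos2Dsin2 B.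
set p := complex.Re u in re im; set q := complex.Im u in re im.
have im0 : sin B * (1 - p) - cos B * q = 0.
  by apply: (mulfI E0); rewrite im mulr0.
have re1 : cos B * (1 - p) + sin B * q = E^-1.
  by apply: (mulfI E0); rewrite re divff.
rewrite (_ : 1 - u = (1 - p) +i* (- q)); last first.
  by rewrite /p /q; case: (u) => a b /=; simpc.
rewrite -re1; simpc; congr (_ +i* _).
  transitivity ((cos B ^+ 2 + sin B ^+ 2) * (1 - p) -
    sin B * (sin B * (1 - p) - cos B * q)); first by ring.
  by rewrite cs im0; ring.
transitivity (- (cos B ^+ 2 + sin B ^+ 2) * q -
  cos B * (sin B * (1 - p) - cos B * q)); first by ring.
by rewrite cs im0; ring.
Qed.

End PowerSeries.

(** * The Grunsky coefficients of the Joukowski map *)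

Section JoukowskiGrunsky.
Variable R : realType.
Implicit Types (k : R) (z w : R[i]).

Definition joukowski k z : R[i] := z + k%:C / z.

Definition joukowski_coef k : nat -> nat -> R[i] :=
  fun m n => if m == n then (k ^+ n.+1 / n.+1%:R)%:C else 0.

Lemma DstarP z : Dstar z <-> 1 < normc z.
Proof. by rewrite /Dstar /= -ltcR. Qed.

Lemma Dstar_neq0 z : Dstar z -> z != 0.
Proof. by move=> /DstarP; apply: contraTneq => ->; rewrite normc0 ltr10. Qed.

Lemma normc_real k : normc k%:C = `|k|.
Proof. by rewrite /= expr0n addr0 sqrtr_sqr. Qed.

Lemma normc_div_lt1 k z w : 0 <= k < 1 -> Dstar z -> Dstar w ->
  normc (k%:C / (z * w)) < 1.
Proof.
move=> /andP[k0 k1] /DstarP z1 /DstarP w1.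
have zw : 1 < normc z * normc w by rewrite -[1]mulr1 ltr_pM.
rewrite normcM normcV normcM normc_real ger0_norm// ltr_pdivrMr ?mul1r.
  exact: lt_trans zw.
exact: lt_trans zw.
Qed.

(** The divided difference of the Joukowski map has the form [1 - u], so its
    logarithm is a power series in [1 / (z w)]: the Grunsky matrix is diagonal. *)
Lemma joukowski_divdiff k z w : z != 0 -> w != 0 -> z != w ->
  (joukowski k z - joukowski k w) / (z - w) = 1 - k%:C / (z * w).
Proof.
move=> z0 w0; rewrite -subr_eq0 => zw.
by rewrite /joukowski; field; rewrite zw z0 w0.
Qed.

Lemma joukowski_coef_term k z w m n : z != 0 -> w != 0 ->
  joukowski_coef k m n * z ^- m.+1 * w ^- n.+1 =
  if m == n then (k%:C / (z * w)) ^+ n.+1 / n.+1%:R else 0.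
Proof.
move=> z0 w0; rewrite /joukowski_coef; case: eqP => [->|_]; last by rewrite !mul0r.
rewrite rmorphM fmorphV rmorphXn rmorph_nat expr_div_n exprMn.
by field; rewrite !expf_neq0// nat1r pnatr_eq0.
Qed.

Lemma square_sum_diag (a : nat -> R[i]) :
  square_sum (fun m n => if m == n then a n else 0) = series a.
Proof.
apply/funext => N; rewrite /square_sum /series/= big_mkord; apply: eq_bigr => m _.
rewrite (bigD1 m)//= eqxx big1 ?addr0// => i im.
by rewrite -val_eqE in im; rewrite eq_sym (negbTE im).
Qed.

Lemma esum_diag (a : nat -> \bar R) : (forall n, 0 <= a n)%E ->
  \esum_(p in [set: nat * nat]) (if p.1 == p.2 then a p.2 else 0)%E =
  (\sum_(n <oo) a n)%E.
Proof.
move=> a0; have diag_inj : set_inj [set: nat] (fun n : nat => (n, n)).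
  by move=> m n _ _ [].
rewrite nneseries_esumT//.
rewrite -(@esum_image _ _ _ _ _ (fun p : nat * nat => a p.2) diag_inj).
rewrite [RHS]esum_mkcond; apply: eq_esum => -[m n] _ /=.
case: (eqVneq m n) => [->|mn]; first by rewrite ifT// inE; exists n.
by rewrite ifF//; apply/negP; rewrite inE => -[i _ [im jn]];
  rewrite -im -jn eqxx in mn.
Qed.

Lemma grunsky_joukowski k : 0 <= k < 1 ->
  grunsky_coef (joukowski k) (joukowski_coef k).
Proof.
move=> k01 z w Dz Dw a.
have z0 := Dstar_neq0 Dz; have w0 := Dstar_neq0 Dw.
set u := k%:C / (z * w); have u1 : normc u < 1 by exact: normc_div_lt1.
have aE : a = fun m n => if m == n then u ^+ n.+1 / n.+1%:R else 0.
  by apply/funext => m; apply/funext => n; rewrite /a joukowski_coef_term.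
split; last first.
  have [S uS expS] := cvg_log_series u1; exists S.
    by rewrite aE square_sum_diag.
  by move=> zw; rewrite expS joukowski_divdiff.
pose f n := normc (u ^+ n.+1 / n.+1%:R).
have f0 n : 0 <= f n by exact: normc_ge0.
have -> : \esum_(p in [set: nat * nat]) (normc (a p.1 p.2))%:E =
    (\sum_(n <oo) (f n)%:E)%E.
  rewrite -esum_diag// aE; apply: eq_esum => -[m n] _ /=.
  by case: ifP; rewrite ?normc0.
have cf : cvgn (series f).
  apply: (@series_le_cvg _ _ (geometric 1 (normc u))) => // [n|n|].
  - by rewrite /= mul1r exprn_ge0// normc_ge0.
  - rewrite /f normcM normcX normcV -(rmorph_nat (real_complex R)) normc_real.
    rewrite ger0_norm//= mul1r ler_pdivrMr// exprSr.
    rewrite ler_pM ?exprn_ge0 ?normc_ge0//.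
    by rewrite (le_trans (ltW u1))// ler1n.
  - by apply: is_cvg_geometric_series; rewrite ger0_norm// normc_ge0.
have -> : (\sum_(n <oo) (f n)%:E)%E = (limn (series f))%:E.
  by rewrite -EFin_lim//; apply: congr_lim; apply/funext => n /=;
    rewrite /series/= sumEFin.
exact: ltry.
Qed.

Lemma cexpD z w : cexp (z + w) = cexp z * cexp w.
Proof.
case: z w => a b [c d]; rewrite /cexp/= expRD cosD sinD.
by simpc; congr (_ +i* _); ring.
Qed.

(** Halving the coefficients replaces the divided difference by a square root of
    it, and square roots of [(z - w)^2 (1 - k / (z w))] cannot be chosen additively:
    three points of the real axis suffice. *)
Lemma half_joukowski_coef_not_grunsky k g : 0 < k < 1 ->
  ~ grunsky_coef g ((2^-1 : R)%:C *: joukowski_coef k).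
Proof.
move=> /andP[k0 k1] gc.
have k01 : 0 <= k < 1 by rewrite ltW.
have sq z w : Dstar z -> Dstar w -> z != w ->
    (g z - g w) ^+ 2 = (z - w) ^+ 2 * (1 - k%:C / (z * w)).
  move=> Dz Dw zw.
  have [_ [S SE expS]] := gc z w Dz Dw.
  have [_ [T TE expT]] := grunsky_joukowski k01 Dz Dw.
  have ST : S = (2^-1)%:C * T.
    apply: (cvg_unique (@norm_hausdorff _ _) SE).
    rewrite (_ : square_sum _ = fun N => (2^-1)%:C * square_sum
      (fun m n => joukowski_coef k m n * z ^- m.+1 * w ^- n.+1) N).
      exact: cvgM (cvg_cst _) TE.
    apply/funext => N; rewrite /square_sum mulr_sumr; apply: eq_bigr => m _.
    by rewrite mulr_sumr; apply: eq_bigr => n _; rewrite !mulrA.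
  have TS : T = S + S by rewrite ST -mulrDl -rmorphD -[X in X + X]mul1r -splitr mul1r.
  have zw0 : z - w != 0 by rewrite subr_eq0.
  have := expT zw; rewrite TS opprD cexpD expS// joukowski_divdiff ?Dstar_neq0// => <-.
  by field.
have DR (x : R) : 1 < `|x| -> Dstar x%:C by move=> x1; apply/DstarP; rewrite normc_real.
have D2 : Dstar (2 : R)%:C by apply: DR; rewrite ger0_norm ?ltr1n.
have DN2 : Dstar (-2 : R)%:C by apply: DR; rewrite normrN ger0_norm ?ltr1n.
have D4 : Dstar (4 : R)%:C by apply: DR; rewrite ger0_norm ?ltr1n.
have neqC (x y : R) : x != y -> x%:C != y%:C by move=> xy; apply: contra_neq xy => -[].
have A : (g (2 : R)%:C - g (-2 : R)%:C) ^+ 2 = (16 + 4 * k)%:C.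
  rewrite sq ?neqC//; last by rewrite gt_eqF//; lra.
  rewrite -(rmorph1 (real_complex R)) -!(rmorphM, rmorphB, fmorphV, rmorphXn)/=.
  by congr (real_complex _); field.
have B : (g (-2 : R)%:C - g (4 : R)%:C) ^+ 2 = (36 + 9 * k / 2)%:C.
  rewrite sq ?neqC//; last by rewrite lt_eqF//; lra.
  rewrite -(rmorph1 (real_complex R)) -!(rmorphM, rmorphB, fmorphV, rmorphXn)/=.
  by congr (real_complex _); field.
have C : (g (2 : R)%:C - g (4 : R)%:C) ^+ 2 = (4 - k / 2)%:C.
  rewrite sq ?neqC//; last by rewrite lt_eqF//; lra.
  rewrite -(rmorph1 (real_complex R)) -!(rmorphM, rmorphB, fmorphV, rmorphXn)/=.
  by congr (real_complex _); field.
set x := g _ - g (-2)%:C in A; set y := g (-2)%:C - _ in B.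
have xy : g (2 : R)%:C - g (4 : R)%:C = x + y by rewrite /x /y addrA subrK.
(* In terms of the real numbers found above, the two sides are [(48 + 9 k)^2] and
   [(48 + 9 k)^2 - 9 k^2]. *)
have : ((x + y) ^+ 2 - x ^+ 2 - y ^+ 2) ^+ 2 = 4%:C * x ^+ 2 * y ^+ 2.
  by rewrite (rmorph_nat (real_complex R)); ring.
rewrite -xy A B C -!(rmorphM, rmorphB, rmorphXn)/= => /complexI.
have k2 : 0 < k ^+ 2 by rewrite exprn_gt0.
by rewrite expr2 in k2 *; lra.
Qed.

End JoukowskiGrunsky.

(** * Membership in the space of coefficients and univalence *)

Section JoukowskiSpace.
Variable R : realType.
Implicit Types (k : R) (z w : R[i]).

Lemma sqrtrM_nat n : Num.sqrt (n.+1 * n.+1)%:R = n.+1%:R :> R.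
Proof. by rewrite natrM -expr2 sqrtr_sqr ger0_norm. Qed.

Lemma wcoef_joukowski_coef k m n :
  wcoef (joukowski_coef k) m n = if m == n then (k ^+ n.+1)%:C else 0.
Proof.
rewrite /wcoef /joukowski_coef; case: eqP => [->|_]; last by rewrite mulr0.
by rewrite -rmorphM sqrtrM_nat mulrC divfK// pnatr_eq0.
Qed.

(** The weights [sqrt (m n)] turn the diagonal entries [k^n / n] into [k^n], and the
    form into a contraction of the sum of squares. *)
Lemma quad_sum_joukowski_coef k x N :
  quad_sum (joukowski_coef k) x N = \sum_(n < N) (k ^+ n.+1)%:C * x n ^+ 2.
Proof.
rewrite /quad_sum; transitivity (series (fun n => (k ^+ n.+1)%:C * x n ^+ 2) N).
  rewrite -square_sum_diag; congr (square_sum _ N).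
  apply/funext => m; apply/funext => n; rewrite wcoef_joukowski_coef.
  by case: eqP => [->|_]; rewrite ?mul0r// -mulrA.
by rewrite /series/= big_mkord.
Qed.

Lemma joukowski_coef_gspace k : 0 <= k < 1 -> gspace (joukowski_coef k).
Proof.
move=> /andP[k0 k1].
have kX n : normc (k ^+ n)%:C <= 1.
  by rewrite normc_real ger0_norm ?exprn_ge0// exprn_ile1// ltW.
have wle1 m n : normc (wcoef (joukowski_coef k) m n) <= 1.
  by rewrite wcoef_joukowski_coef; case: ifP; rewrite ?normc0 ?kX.
split.
- by move=> m n; rewrite /joukowski_coef eq_sym; case: eqP => [->|].
- exists 1 => m n; rewrite ler_pdivlMr ?sqrtr_gt0 ?ltr0n//.
  apply: le_trans (wle1 m n); rewrite /wcoef normcM normc_real mulrC.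
  by rewrite ger0_norm// sqrtr_ge0.
- apply: (@le_lt_trans _ _ (1 + 1)%:E); last exact: ltry.
  rewrite EFinD /gnorm leeD//; apply: ge_ereal_sup.
    by move=> _ [p _ <-]; rewrite lee_fin.
  move=> _ [x x1 <-].
  apply: (@le_trans _ _ (limn_esup (fun N : nat => 1%:E))); last first.
    have c1 : (fun=> 1%:E : \bar R) @ \oo --> 1%:E by exact: cvg_cst.
    by rewrite is_cvg_limn_esupE ?(cvg_lim _ c1)//; exact: cvgP c1.
  apply: limn_esup_le => N; rewrite lee_fin quad_sum_joukowski_coef.
  have xN : \sum_(n < N) normc (x n) ^+ 2 <= 1.
    have := x1; rewrite /unit_l2/=; set S := series _ => S1.
    rewrite -(big_mkord xpredT (fun n => normc (x n) ^+ 2)) -[leLHS]/(S N).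
    rewrite -(cvg_lim _ S1)//; apply: nondecreasing_cvgn_le; last exact: cvgP S1.
    by apply: nondecreasing_series => ? _ _; rewrite exprn_ge0 ?normc_ge0.
  apply: le_trans xN; elim/big_ind2 : _ => [|a b c d ab cd|n _].
  - by rewrite normc0.
  - by rewrite (le_trans (le_normcD _ _))// lerD.
  - by rewrite normcM normcX ler_piMl ?exprn_ge0 ?normc_ge0.
Qed.

Lemma joukowski_Sigma k : 0 <= k < 1 -> Sigma (joukowski k).
Proof.
move=> k01; have /andP[k0 k1] := k01; split.
- move=> z /Dstar_neq0 z0; apply: derivableD; first exact: derivable_id.
  apply: derivableM; first exact: derivable_cst.
  by apply: derivableV.
- move=> z w; rewrite !inE => Dz Dw zw; apply/eqP/negPn/negP => neq.
  have := joukowski_divdiff k (Dstar_neq0 Dz) (Dstar_neq0 Dw) neq.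
  rewrite zw subrr mul0r => /esym/eqP; rewrite subr_eq0 => /eqP e1.
  by have := normc_div_lt1 k01 Dz Dw; rewrite -e1 normc1 ltxx.
- move=> z Dz; have z0 := Dstar_neq0 Dz; apply/eqP => /eqP.
  rewrite /joukowski addr_eq0 => /eqP zk.
  have := normc_div_lt1 k01 Dz Dz.
  have -> : k%:C / (z * z) = - (- (k%:C / z)) / z by field.
  by rewrite -zk mulNr divff// normcN normc1 ltxx.
- exists (fun n => if n == 0%N then k%:C else 0) => z Dz.
  apply: cvg_near_cst; exists 1%N => // n /= n1.
  rewrite /series/= big_ltn//= expr1 big_nat big1 ?addr0.
    by rewrite /joukowski addrAC subrr add0r.
  by move=> i /andP[i0 _]; rewrite gtn_eqF// mul0r.
Qed.

End JoukowskiSpace.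

(** * The quasiconformal extension *)

Section JoukowskiQC.
Variable R : realType.
Implicit Types (k : R) (z w v : R[i]).

Lemma normc_le1 z :
  (normc z <= 1) = (complex.Re z ^+ 2 + complex.Im z ^+ 2 <= 1).
Proof. by case: z => a b /=; rewrite -{1}[1]sqrtr1 ler_sqrt. Qed.

Lemma normc_conj z : normc z^* = normc z.
Proof. by case: z => a b /=; rewrite sqrrN. Qed.

(** Inversion in the unit circle outside of it, then complex conjugation
    everywhere. *)
Definition reflect_disk z : R[i] := if normc z <= 1 then z^* else z^-1.

(** After multiplication by [|w|] and squaring, the difference of the two sides is
    [(|w|^2 - 1) (|z - w|^2 + 1 - |z|^2)]. *)
Lemma reflect_disk_mixed z w : normc z <= 1 -> 1 < normc w ->
  normc (z^* - w^-1) <= normc (z - w).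
Proof.
move=> z1 w1; have w0 : w != 0 by apply: Dstar_neq0; apply/DstarP.
rewrite -(@ler_pM2r _ (normc w)) ?(lt_trans _ w1)// -!normcM mulrBl mulVf//.
move: w1; rewrite ltNge !normc_le1 -ltNge in z1 *.
case: z w z1 {w0} => a b [c d] /= z1 w1; simpc.
rewrite ler_sqrt ?addr_ge0 ?sqr_ge0// -subr_ge0.
have -> : ((a - c) * c - (b - d) * d) ^+ 2 + ((a - c) * d + (b - d) * c) ^+ 2 -
    ((a * c + b * d - 1) ^+ 2 + (a * d - b * c) ^+ 2) =
    (c ^+ 2 + d ^+ 2 - 1) * ((a - c) ^+ 2 + (b - d) ^+ 2 + (1 - (a ^+ 2 + b ^+ 2))).
  by ring.
apply: mulr_ge0; first by rewrite subr_ge0 ltW.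
by apply: addr_ge0; rewrite ?subr_ge0// addr_ge0 ?sqr_ge0.
Qed.

Lemma reflect_disk_lipschitz z w :
  normc (reflect_disk z - reflect_disk w) <= normc (z - w).
Proof.
rewrite /reflect_disk.
have [z1|z1] := leP (normc z) 1; have [w1|w1] := leP (normc w) 1.
- by rewrite -rmorphB normc_conj.
- exact: reflect_disk_mixed.
- by rewrite -normcN opprB -[leRHS]normcN opprB reflect_disk_mixed.
- have z0 : z != 0 by apply: Dstar_neq0; apply/DstarP.
  have w0 : w != 0 by apply: Dstar_neq0; apply/DstarP.
  have -> : z^-1 - w^-1 = - (z - w) / (z * w) by field; rewrite z0 w0.
  have zw : 1 < normc z * normc w by rewrite -[1]mulr1 ltr_pM.
  rewrite normcM normcV normcN normcM ler_pdivrMr ?(lt_trans _ zw)//.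
  by rewrite ler_peMr ?normc_ge0// ltW.
Qed.

Definition joukowski_ext k z : R[i] := z + k%:C * reflect_disk z.

Lemma joukowski_extE k z : 1 < normc z -> joukowski_ext k z = joukowski k z.
Proof. by rewrite ltNge /joukowski_ext /reflect_disk => /negbTE ->. Qed.

Lemma joukowski_ext_lipschitz k z w : 0 <= k ->
  normc (joukowski_ext k z - joukowski_ext k w) <= (1 + k) * normc (z - w).
Proof.
move=> k0; rewrite /joukowski_ext opprD addrACA -mulrBr.
rewrite (le_trans (le_normcD _ _))// mulrDl mul1r lerD2l normcM normc_real ger0_norm//.
by rewrite ler_wpM2l// reflect_disk_lipschitz.
Qed.

(** Together with the Lipschitz bound, this makes the map a bi-Lipschitz embedding
    of the plane. *)
Lemma joukowski_ext_expand k z w : 0 <= k ->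
  (1 - k) * normc (z - w) <= normc (joukowski_ext k z - joukowski_ext k w).
Proof.
move=> k0; rewrite mulrBl mul1r lerBlDr.
have {1}-> : z - w = (joukowski_ext k z - joukowski_ext k w) -
    k%:C * (reflect_disk z - reflect_disk w) by rewrite /joukowski_ext; ring.
rewrite (le_trans (le_normcD _ _))// lerD2l normcN normcM normc_real ger0_norm//.
by rewrite ler_wpM2l// reflect_disk_lipschitz.
Qed.

(** The map [z + k / z] sends the ring [k <= |z| <= 1] into the ellipse that is the
    image of the unit disk under [z + k z^*]. Both bounds in the proof come down to
    [(s - 1) (s - k^2) <= 0] with [s = |z|^2]. *)
Lemma joukowski_annulus_in_ellipse k a b (s := a ^+ 2 + b ^+ 2) : 0 < k < 1 ->
  k ^+ 2 <= s -> s <= 1 ->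
  (a * (1 + k / s) / (1 + k)) ^+ 2 + (b * (1 - k / s) / (1 - k)) ^+ 2 <= 1.
Proof.
move=> /andP[k0 k1] ks s1.
have s0 : 0 < s by apply: lt_le_trans ks; rewrite exprn_gt0.
have main : (s - 1) * (s - k ^+ 2) <= 0.
  by rewrite mulr_le0_ge0 ?subr_le0 ?subr_ge0.
have h1 : ((1 + k / s) / (1 + k)) ^+ 2 <= s^-1.
  rewrite -subr_ge0 (_ : _ - _ = - ((s - 1) * (s - k ^+ 2)) / (s * (1 + k)) ^+ 2).
    by rewrite divr_ge0 ?oppr_ge0 ?sqr_ge0.
  by field; rewrite !gt_eqF//; lra.
have h2 : ((1 - k / s) / (1 - k)) ^+ 2 <= s^-1.
  rewrite -subr_ge0 (_ : _ - _ = - ((s - 1) * (s - k ^+ 2)) / (s * (1 - k)) ^+ 2).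
    by rewrite divr_ge0 ?oppr_ge0 ?sqr_ge0.
  by field; rewrite !gt_eqF//; lra.
rewrite -!mulrA exprMn [X in _ + X]exprMn.
apply: (@le_trans _ _ (a ^+ 2 * s^-1 + b ^+ 2 * s^-1)).
  by rewrite lerD// ler_wpM2l// sqr_ge0.
by rewrite -mulrDl divff// gt_eqF.
Qed.

(** For a point outside the ellipse, the two roots of [z + k / z = y] have product
    [k]. If neither lies outside the unit circle then both lie in the ring
    [k <= |z| <= 1], which is mapped into the ellipse. *)
Lemma joukowski_ext_surj k y : 0 < k < 1 -> exists z, joukowski_ext k z = y.
Proof.
move=> k01; have /andP[k0 k1] := k01.
case: y => y1 y2.
pose x : R[i] := (y1 / (1 + k)) +i* (y2 / (1 - k)).
have [x1|x1] := leP (normc x) 1.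
  exists x; rewrite /joukowski_ext /reflect_disk x1 /x; simpc.
  by congr (_ +i* _); field; rewrite gt_eqF//; lra.
pose y := y1 +i* y2.
pose z := (y + sqrtc (y ^+ 2 - 4 * k%:C)) / 2.
have zy : z * (y - z) = k%:C.
  have sq := sqr_sqrtc (y ^+ 2 - 4 * k%:C).
  rewrite /z; set r := sqrtc _ in sq *.
  transitivity ((y ^+ 2 - r ^+ 2) / 4); first by field.
  by rewrite sq; field.
have kC0 : k%:C != 0 :> R[i] by rewrite eq_complex/= negb_and gt_eqF.
have z0 : z != 0 by apply: contra_neq kC0 => z0; rewrite -zy z0 mul0r.
have yz0 : y - z != 0 by apply: contra_neq kC0 => z0'; rewrite -zy z0' mulr0.
have out w : w * (y - w) = k%:C -> w != 0 -> 1 < normc w -> joukowski_ext k w = y.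
  by move=> wy w0 w1; rewrite joukowski_extE// /joukowski -wy mulrC mulKf// addrC subrK.
have [z1|z1] := ltP 1 (normc z); first by exists z; exact: out.
have [z2|z2] := ltP 1 (normc (y - z)).
  by exists (y - z); apply: out => //; rewrite subKr mulrC.
have kz : k <= normc z.
  rewrite -[leLHS](ger0_norm (ltW k0)) -normc_real -zy normcM ler_piMr ?normc_ge0//.
have yE : y = z + k%:C / z by rewrite -zy mulrAC divff// mul1r addrC subrK.
exfalso; move: x1; apply/negP; rewrite -leNgt normc_le1.
case: z yE z1 kz {zy z0 yz0 z2 out} => a b yE z1 kz.
set s := a ^+ 2 + b ^+ 2.
have s1 : s <= 1 by move: z1; rewrite normc_le1.
have ks : k ^+ 2 <= s.
  have : k ^+ 2 <= normc (a +i* b) ^+ 2 by rewrite lerXn2r ?nnegrE ?normc_ge0// ltW.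
  by rewrite /= sqr_sqrtr// addr_ge0 ?sqr_ge0.
have := joukowski_annulus_in_ellipse k01 ks s1.
have s0 : 0 < s by apply: lt_le_trans ks; rewrite exprn_gt0.
have -> : a * (1 + k / s) = y1.
  by have := congr1 (@complex.Re R) yE; rewrite /y /= => ->; rewrite -/s; field; rewrite gt_eqF.
have -> : b * (1 - k / s) = y2.
  by have := congr1 (@complex.Im R) yE; rewrite /y /= => ->; rewrite -/s; field; rewrite gt_eqF.
by [].
Qed.

Lemma lipschitz_continuous (f : R[i] -> R[i]) L :
  (forall z w, normc (f z - f w) <= L * normc (z - w)) ->
  continuous f.
Proof.
move=> fL z; apply: (cvg_normc (nbhs_filter z)) => e e0.
have L0 : 0 < `|L| + 1 by rewrite ltr_pwDr.
have d0 : 0 < (e / (`|L| + 1))%:C :> R[i] by rewrite ltcR divr_gt0.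
near=> w; apply: (le_lt_trans (fL z w)).
have : normc (z - w) < e / (`|L| + 1).
  rewrite -ltcR; near: w.
  by apply: (@cvgr_dist_lt _ _ _ (nbhs z) _ id z) => //; exact: cvg_id.
rewrite ltr_pdivlMr// mulrC; apply: le_lt_trans.
rewrite ler_wpM2r ?normc_ge0//.
by rewrite (le_trans (ler_norm _))// lerDl.
Unshelve. all: by end_near. Qed.

Lemma joukowski_ext_homeo k : 0 < k < 1 -> plane_homeo (joukowski_ext k).
Proof.
move=> k01; have /andP[k0 k1] := k01.
have k1' : 0 < 1 - k by rewrite subr_gt0.
split.
  exact: (lipschitz_continuous (fun z w => joukowski_ext_lipschitz z w (ltW k0))).
have /choice [G FG] : forall y, exists z, joukowski_ext k z = y.
  by move=> y; exact: joukowski_ext_surj.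
have GL z w : normc (G z - G w) <= (1 - k)^-1 * normc (z - w).
  rewrite mulrC ler_pdivlMr// mulrC.
  by rewrite -{2}[z]FG -{2}[w]FG joukowski_ext_expand// ltW.
exists G; split=> //; first exact: (lipschitz_continuous GL).
move=> z; apply/eqP; rewrite -subr_eq0; apply/eqP/eq0_normc/eqP.
have := joukowski_ext_expand (G (joukowski_ext k z)) z (ltW k0).
rewrite FG subrr normc0 pmulr_rle0// => h.
by rewrite eq_le h normc_ge0.
Qed.

Lemma lipschitz_abs_continuous (g : R -> R[i]) L a b : 0 <= L ->
  (forall s t, normc (g s - g t) <= L * `|s - t|) -> abs_continuous a b g.
Proof.
move=> L0 gL e e0; have L1 : 0 < L + 1 by rewrite ltr_wpDl.
exists (e / (L + 1)); first by rewrite divr_gt0.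
move=> n s t st _ ; rewrite ltr_pdivlMr// mulrC; apply: le_lt_trans.
rewrite mulr_sumr; apply: ler_sum => i _; apply: (le_trans (gL _ _)).
have [_ [sti _]] := st i.
by rewrite ger0_norm ?subr_ge0// ler_wpM2r ?subr_ge0// lerDl.
Qed.

Lemma joukowski_ext_ACL k : 0 < k < 1 -> ACL (joukowski_ext k).
Proof.
move=> /andP[k0 k1]; have k1' : 0 <= 1 + k by rewrite addr_ge0// ltW.
split; apply: aeW => y a b; apply: (@lipschitz_abs_continuous _ (1 + k)) => // s t;
  apply: (le_trans (joukowski_ext_lipschitz _ _ (ltW k0))).
  by rewrite (_ : _ - _ = (s - t)%:C) ?normc_real//; simpc.
rewrite (_ : _ - _ = (s - t)%:C * 'i); last by simpc.
by rewrite normcM normc_real /= expr0n expr1n add0r sqrtr1 mulr1.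
Qed.

(** A vertical line meets the circle in at most two points. *)
Lemma ae_off_circle :
  {ae (@lebesgue_measure R \x @lebesgue_measure R)%E, forall p : R * R,
    normc (p.1 +i* p.2) != 1}.
Proof.
pose A := [set p : R * R | p.1 ^+ 2 + p.2 ^+ 2 = 1].
exists A; split.
- rewrite (_ : A = setT `&`
    (fun p : R * R => p.1 ^+ 2 + p.2 ^+ 2) @^-1` [set 1]); last first.
    by rewrite setTI.
  have mf : measurable_fun setT (fun p : R * R => p.1 ^+ 2 + p.2 ^+ 2).
    by apply: measurable_realfun.measurable_funD;
      apply: measurable_realfun.measurable_funX; [exact: measurable_fst|exact: measurable_snd].
  by apply: mf.
- rewrite /= /product_measure1; apply: integral0_eq => x _ /=.
  apply: countable_lebesgue_measure0; apply: finite_set_countable.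
  apply: (@sub_finite_set _ _
    [set Num.sqrt (1 - x ^+ 2); - Num.sqrt (1 - x ^+ 2)]); last first.
    exact: finite_set2.
  move=> y; rewrite /xsection/= inE /A /= => xy.
  have -> : 1 - x ^+ 2 = y ^+ 2 by rewrite -xy addrC addKr.
  rewrite sqrtr_sqr; by case: (ger0P y) => _; [left|right; rewrite opprK].
- move=> p /= /negP; rewrite negbK => /eqP p1; rewrite /A/=.
  by rewrite -[LHS]sqr_sqrtr ?p1 ?expr1n// addr_ge0 ?sqr_ge0.
Qed.

Lemma near0_normcM_lt v (r : R) : 0 < r ->
  \forall h \near (0 : R)^', normc (h%:C * v) < r.
Proof.
move=> r0; have v1 : 0 < normc v + 1 by rewrite ltr_wpDl ?normc_ge0.
have d0 : 0 < r / (normc v + 1) by rewrite divr_gt0.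
near=> h; rewrite normcM normc_real.
have : `|h| < r / (normc v + 1).
  by near: h; apply: dnbhs0_lt.
rewrite ltr_pdivlMr//; apply: le_lt_trans.
by rewrite ler_wpM2l// lerDl.
Unshelve. all: by end_near. Qed.

Lemma has_partial_inside k v z : normc z < 1 ->
  has_partial (joukowski_ext k) v z (v + k%:C * v^*).
Proof.
move=> z1; rewrite /has_partial; apply: cvg_near_cst.
have r0 : 0 < 1 - normc z by rewrite subr_gt0.
near=> h.
have h0 : h != 0 by near: h; exact: nbhs_dnbhs_neq.
have hv : normc (h%:C * v) < 1 - normc z by near: h; exact: near0_normcM_lt.
have zh : normc (z + h%:C * v) <= 1.
  by rewrite ltW// (le_lt_trans (le_normcD _ _))// addrC -ltrBrDr.
rewrite /joukowski_ext /reflect_disk zh (ltW z1).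
have -> : (z + h%:C * v)^* = z^* + h%:C * v^*.
  by case: (z) (v) => a b [c d]; simpc; congr (_ +i* _); ring.
have hC0 : h%:C != 0 :> R[i] by rewrite eq_complex/= negb_and h0.
by field.
Unshelve. all: by end_near. Qed.

Lemma has_partial_outside k v z : 1 < normc z ->
  has_partial (joukowski_ext k) v z ((1 - k%:C / z ^+ 2) * v).
Proof.
move=> z1; rewrite /has_partial.
have r0 : 0 < normc z - 1 by rewrite subr_gt0.
have z0 : z != 0 by apply: Dstar_neq0; apply/DstarP.
have hC : (fun h : R => h%:C) @ (0 : R)^' --> (0 : R[i]).
  by apply: (@cvg_complex _ _ _ _ id (fun=> 0)); [exact: nbhs_dnbhs|exact: cvg_cst].
apply: (@cvg_trans _ ((fun h : R => (1 - k%:C / (z * (z + h%:C * v))) * v) @ (0 : R)^')).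
  apply: near_eq_cvg; near=> h.
  have h0 : h != 0 by near: h; exact: nbhs_dnbhs_neq.
  have hv : normc (h%:C * v) < normc z - 1 by near: h; exact: near0_normcM_lt.
  have zh : 1 < normc (z + h%:C * v).
    rewrite ltrBrDr addrC -ltrBrDr in hv; apply: (lt_le_trans hv).
    rewrite lerBlDr -[normc (h%:C * v)]normcN.
    by apply: le_trans (le_normcD _ _); rewrite addrK.
  have zh0 : z + h%:C * v != 0 by apply: Dstar_neq0; apply/DstarP.
  have hC0 : h%:C != 0 :> R[i] by rewrite eq_complex/= negb_and h0.
  rewrite !joukowski_extE// /joukowski; field.
  by rewrite hC0 zh0 z0.
apply: cvgM; last exact: cvg_cst.
apply: cvgB; first exact: cvg_cst.
apply: cvgM; first exact: cvg_cst.
rewrite expr2; apply: cvgV; first by rewrite mulf_neq0.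
apply: cvgM; first exact: cvg_cst.
rewrite -[X in _ --> X]addr0; apply: cvgD; first exact: cvg_cst.
rewrite -[X in _ --> X](mul0r v); apply: cvgM; [exact: hC|exact: cvg_cst].
Unshelve. all: by end_near. Qed.

(** The derivatives in the directions 1 and i are [1 + k] and [i (1 - k)] inside the
    circle, so that [F_zbar = k] and [F_z = 1]; outside, the map is holomorphic and
    [F_zbar = 0]. *)
Lemma joukowski_ext_qc k : 0 < k < 1 -> quasiconformal k (joukowski_ext k).
Proof.
move=> k01; have /andP[k0 k1] := k01; split.
- exact: joukowski_ext_homeo.
- exact: joukowski_ext_ACL.
have partial1 z : normc z < 1 -> has_partial (joukowski_ext k) 1 z (1 + k%:C).
  move=> z1; have -> : 1 + k%:C = 1 + k%:C * 1^* :> R[i] by congr (1 + _); simpc.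
  exact: has_partial_inside.
have partiali z : normc z < 1 ->
    has_partial (joukowski_ext k) 'i%C z ('i%C - k%:C * 'i%C).
  move=> z1; have -> : 'i%C - k%:C * 'i%C = 'i%C + k%:C * 'i%C^* :> R[i].
    by congr ('i%C + _); simpc.
  exact: has_partial_inside.
have dbar : (1 + k%:C + 'i%C * ('i%C - k%:C * 'i%C)) / 2 = k%:C :> R[i].
  transitivity ((1 + k%:C + 'i%C ^+ 2 * (1 - k%:C)) / 2 : R[i]); first by ring.
  by rewrite sqr_i; field.
have d : (1 + k%:C - 'i%C * ('i%C - k%:C * 'i%C)) / 2 = 1 :> R[i].
  transitivity ((1 + k%:C - 'i%C ^+ 2 * (1 - k%:C)) / 2 : R[i]); first by ring.
  by rewrite sqr_i; field.
apply: negligibleS ae_off_circle => -[x y] /=; apply: contra_not => /=.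
set z := x +i* y; rewrite neq_lt => /orP[z1|z1].
  exists (1 + k%:C), ('i%C - k%:C * 'i%C); split; [exact: partial1|exact: partiali|].
  by rewrite dbar d normr1 mulr1 ger0_norm// ler0c ltW.
exists ((1 - k%:C / z ^+ 2) * 1), ((1 - k%:C / z ^+ 2) * 'i%C).
split; [exact: has_partial_outside..|].
rewrite mulr1 mulrCA -expr2 sqr_i mulrN1 subrr mul0r normr0 mulr_ge0//.
by rewrite ler0c ltW.
Qed.

End JoukowskiQC.

(** * The domain is not starlike *)

Lemma joukowski_Sigma0 (R : realType) (k : R) : 0 < k < 1 -> Sigma0 (joukowski k).
Proof.
move=> k01; have /andP[k0 k1] := k01; have k01' : 0 <= k < 1 by rewrite ltW.
exists k => //; split; first exact: joukowski_Sigma.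
exists (joukowski_ext k); split; first exact: joukowski_ext_qc.
by move=> z; rewrite inE => /DstarP; exact: joukowski_extE.
Qed.

Lemma joukowski_grunsky_set (R : realType) (k : R) : 0 < k < 1 ->
  grunsky_set (joukowski_coef k).
Proof.
move=> k01; exists (joukowski k); first exact: joukowski_Sigma0.
by apply: grunsky_joukowski; case/andP: k01 => /ltW-> ->.
Qed.

Lemma joukowski_coef_Lclosure (R : realType) (k : R) : 0 < k < 1 ->
  joukowski_coef k \in @Lpred R.
Proof.
move=> k01; have gs : gspace (joukowski_coef k).
  by apply: joukowski_coef_gspace; case/andP: k01 => /ltW-> ->.
rewrite inE; split => // e e0; exists (joukowski_coef k).
  split=> //; exists 1%N, (fun=> 1), (fun=> joukowski_coef k); split.
    by move=> _; exact: joukowski_grunsky_set.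
  by rewrite big_ord1 scale1r.
by rewrite subrr gnorm0 lte_fin.
Qed.

Theorem theorem2 (R : realType) :
  ~ starlike_wrt (@Ttilde R) (0 : Lgrunsky R) /\
  exists (c : Lgrunsky R) (t : R),
    [/\ Ttilde c, 0 <= t <= 1 & ~ Ttilde (t%:C *: c)].
Proof.
have k01 : 0 < (2^-1 : R) < 1 by apply/andP; split; lra.
pose c : Lgrunsky R := exist (fun c => c \in @Lpred R) _ (joukowski_coef_Lclosure k01).
have cT : Ttilde c by exact: joukowski_grunsky_set.
have t01 : 0 <= (2^-1 : R) <= 1 by apply/andP; split; lra.
have tcT : ~ Ttilde ((2^-1 : R)%:C *: c).
  by move=> [g _]; exact: half_joukowski_coef_not_grunsky.
split; last by exists c, 2^-1.
move=> /(_ c 2^-1 cT t01); rewrite subr0 add0r; exact: tcT.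
Qed.
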